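(* Let $n\in\mathbb{N}$ and $1<p<\infty$. For every $0<\varepsilon<1$ there exists an open set $G\subset\mathbb{R}^n$ with Lebesgue measure $|G|<\varepsilon$ such that $$\varlimsup_{\alpha\to0+}\alpha\,\operatorname{cap}(G;B_{p,p}^\alpha)\ge1.$$ Consequently, there exist open sets $G\subset\mathbb{R}^n$ for which (with $q=p$) the equality $$\lim_{\alpha\to0+}\alpha^{p/q}\operatorname{cap}(G;B_{p,q}^\alpha)=2n^p\left(\frac1q\right)^{p/q}|G|$$ fails.
   Context: Here $e_k$ is the $k$th unit coordinate vector. For $f\in L^p(\mathbb{R}^n)$, $1\le p<\infty$, the partial modulus of continuity is $$\omega_k(f;\delta)_p=\sup_{0\le h\le\delta}\left(\int_{\mathbb{R}^n}|f(x+he_k)-f(x)|^p\,dx\right)^{1/p}.$$ For $0<\alpha<1$, $1\le p,q<\infty$, $$\|f\|_{b^\alpha_{p,q;k}}=\left(\int_0^\infty\left(t^{-\alpha}\omega_k(f;t)_p\right)^q\frac{dt}{t}\right)^{1/q},\qquad \|f\|_{b^\alpha_{p,q}}=\sum_{k=1}^n\|f\|_{b^\alpha_{p,q;k}}.$$ For a compact set $K\subset\mathbb{R}^n$, let $\mathfrak{N}(K)$ be the set of all $f\in C_0^\infty(\mathbb{R}^n)$ (smooth, compactly supported) such that $f(x)\ge1$ for all $x\in K$, and define $$\operatorname{cap}(K;B_{p,q}^\alpha)=\inf\left\{\|f\|_{b^\alpha_{p,q}}^p: f\in\mathfrak{N}(K)\right\}.$$ For an open set $G\subset\mathbb{R}^n$,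 $\operatorname{cap}(G;B_{p,q}^\alpha)=\sup\{\operatorname{cap}(K;B_{p,q}^\alpha):K\subset G,\ K\text{ compact}\}$ (possibly $+\infty$). *)

(* Defs.v *)
From HB Require Import structures.
From mathcomp Require Import all_boot all_order all_algebra.
From mathcomp Require Import all_classical all_reals all_analysis.
From mathcomp Require Import measurable_realfun.

Set Implicit Arguments.
Unset Strict Implicit.
Unset Printing Implicit Defensive.
Import Order.TTheory GRing.Theory Num.Theory.
Import numFieldNormedType.Exports.

Local Open Scope classical_set_scope.
Local Open Scope ring_scope.

(* R^n is 'rV[R]_n, measurable with its Borel sigma-algebra. The library norms
   it by the sup norm, of which only the topology is used here. *)
Section borel_rV.
Variables (R : realType) (n : nat).

Definition borel_rV : set (set 'rV[R]_n) := <<s [set U | open U] >>.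

Let borel_rV0 : borel_rV set0.
Proof. exact: sigma_algebra0. Qed.

Let borel_rVC A : borel_rV A -> borel_rV (~` A).
Proof. exact: sigma_algebraC. Qed.

Let borel_rV_bigcup (F : _^nat) :
  (forall i, borel_rV (F i)) -> borel_rV (\bigcup_i (F i)).
Proof. exact: sigma_algebra_bigcup. Qed.

HB.instance Definition _ := @isMeasurable.Build default_measure_display 'rV[R]_n
  borel_rV borel_rV0 borel_rVC borel_rV_bigcup.

End borel_rV.

Lemma measurable_open_rV (R : realType) n (U : set 'rV[R]_n) :
  open U -> measurable U.
Proof. by move=> oU; apply: sub_sigma_algebra. Qed.

Lemma measurable_fun_rVP (R : realType) n d (T : measurableType d)
    (f : T -> 'rV[R]_n) :
  (forall i, measurable_fun [set: T] (fun t => f t 0 i)) ->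
  measurable_fun [set: T] f.
Proof.
move=> mf; apply: (measurability [set U : set 'rV[R]_n | open U]) => //.
move=> _ [U oU <-]; rewrite setTI.
pose B (c : 'rV[rat]_n * nat) : set 'rV[R]_n :=
  ball (map_mx ratr c.1 : 'rV[R]_n) c.2.+1%:R^-1.
have -> : f @^-1` U = \bigcup_(c in [set c | B c `<=` U]) (f @^-1` B c).
  rewrite eqEsubset; split => [t Uft|t [c /= cU Bft]]; last exact: cU.
  have /nbhs_ballP[e /= e0 eU] := open_nbhs_nbhs (conj oU Uft).
  have [k ke] : exists k : nat, k.+1%:R^-1 < e / 2.
    have e20 : 0 < e / 2 by rewrite divr_gt0.
    have [k _ /(_ k (leqnn k))] := near_infty_natSinv_lt (PosNum e20).
    by exists k.
  have k0 : 0 < (k.+1%:R^-1 : R) by rewrite invr_gt0.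
  have /choice[q qP] : forall i, exists q : rat,
      ball (ratr q : R) k.+1%:R^-1 (f t 0 i).
    move=> i.
    have [q qr] : exists q : rat,
        ratr q \in `](f t 0 i - k.+1%:R^-1), (f t 0 i + k.+1%:R^-1)[.
      by apply: rat_in_itvoo; rewrite ltrD2l gtrN.
    by exists q; move: qr; rewrite in_itv/= -ltr_distl.
  have Bc : B (\row_i q i, k) (f t).
    by split => // i j; rewrite !mxE ord1; exact: qP.
  exists (\row_i q i, k) => //= y By; apply: eU.
  apply: (@le_ball _ _ _ (k.+1%:R^-1 + k.+1%:R^-1)).
    by rewrite (splitr e) lerD// ltW.
  by apply: ball_triangle By; exact: ball_sym.
rewrite bigcup_mkcond; apply: countable_bigcupT_measurable => // -[q k].
case: ifPn => // _.
have -> : f @^-1` B (q, k) = \bigcap_(i : 'I_n)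
    ((fun t => f t 0 i) @^-1` ball (ratr (q 0 i) : R) k.+1%:R^-1).
  rewrite eqEsubset; split => [t [_ Bt] i _ /=|t Bt].
    by have := Bt 0 i; rewrite mxE.
  by split => [|i j]; rewrite ?invr_gt0// mxE ord1; exact: Bt.
apply: fin_bigcap_measurable => [|i _]; first exact: finite_finset.
rewrite -[X in measurable X]setTI; apply: mf => //.
exact: measurable_ball.
Qed.

Lemma measurable_coord_rV (R : realType) n (i : 'I_n) :
  measurable_fun [set: 'rV[R]_n] (fun v => v 0 i).
Proof.
apply: (measurability _ (RGenOpens.measurableE R)) => // _ [_ [a [b ->]] <-].
rewrite setTI; apply: measurable_open_rV; apply: open_comp.
  by move=> v _; exact: coord_continuous.
exact: interval_open.
Qed.

Definition cons_rV (R : realType) n (u : R * 'rV[R]_n) : 'rV[R]_n.+1 :=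
  row_mx u.1%:M u.2 : 'rV[R]_(1 + n).

Lemma cons_rV0 (R : realType) n (u : R * 'rV[R]_n) : cons_rV u 0 0 = u.1.
Proof.
by rewrite mxE; case: splitP => j //=; rewrite ord1 mxE eqxx mulr1n.
Qed.

Lemma cons_rVS (R : realType) n (u : R * 'rV[R]_n) i :
  cons_rV u 0 (lift 0 i) = u.2 0 i.
Proof.
rewrite mxE; case: splitP => j /=; first by rewrite ord1.
by rewrite /bump/= !add1n => -[] /val_inj <-.
Qed.

Definition uncons_rV (R : realType) n (v : 'rV[R]_n.+1) : R * 'rV[R]_n :=
  (v 0 0, \row_i v 0 (lift 0 i)).

Lemma cons_rVK (R : realType) n : cancel (@cons_rV R n) (@uncons_rV R n).
Proof.
move=> [x v]; rewrite /uncons_rV cons_rV0; congr pair.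
by apply/rowP => i; rewrite mxE cons_rVS.
Qed.

Lemma measurable_cons_rV (R : realType) n :
  measurable_fun [set: R * 'rV[R]_n] (@cons_rV R n).
Proof.
apply: measurable_fun_rVP => i; have [j ->|->] := unliftP 0 i.
  under eq_fun do rewrite cons_rVS.
  exact: (measurableT_comp (measurable_coord_rV j) measurable_snd).
by under eq_fun do rewrite cons_rV0; exact: measurable_fst.
Qed.

Lemma measurable_uncons_rV (R : realType) n :
  measurable_fun [set: 'rV[R]_n.+1] (@uncons_rV R n).
Proof.
apply: measurable_fun_pair; first exact: measurable_coord_rV.
apply: measurable_fun_rVP => i; under eq_fun do rewrite mxE.
exact: measurable_coord_rV.
Qed.

Section cons_measure.
Local Open Scope ereal_scope.
Variables (R : realType) (n : nat).
Variable mu : {sigma_finite_measure set 'rV[R]_n -> \bar R}.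

Definition cons_measure : set 'rV[R]_n.+1 -> \bar R :=
  pushforward (@lebesgue_measure R \x mu) (@cons_rV R n).

Let cons_measure0 : cons_measure set0 = 0.
Proof. by rewrite /cons_measure /pushforward preimage_set0 measure0. Qed.

Let cons_measure_ge0 A : 0 <= cons_measure A.
Proof. by rewrite /cons_measure /pushforward measure_ge0. Qed.

Let cons_measure_sigma_additive : semi_sigma_additive cons_measure.
Proof.
have mcons A : measurable A -> measurable (@cons_rV R n @^-1` A).
  by move=> mA; rewrite -[X in measurable X]setTI; exact: measurable_cons_rV.
move=> F mF tF mUF; rewrite /cons_measure /pushforward preimage_bigcup.
apply: measure_semi_sigma_additive => [k||]; first exact: mcons.
- apply/trivIsetP => /= i j _ _ ij; rewrite -preimage_setI.
  by move/trivIsetP : tF => /(_ _ _ _ _ ij) ->//; rewrite preimage_set0.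
- by rewrite -preimage_bigcup; exact: mcons.
Qed.

HB.instance Definition _ := isMeasure.Build _ _ _ cons_measure
  cons_measure0 cons_measure_ge0 cons_measure_sigma_additive.

Let cons_measure_sigma_finite : sigma_finite [set: 'rV[R]_n.+1] cons_measure.
Proof.
have /sigma_finiteP[F [TF ndF Foo]] := sigma_finiteT (@lebesgue_measure R).
have /sigma_finiteP[G [TG ndG Goo]] := sigma_finiteT mu.
exists (fun k => @uncons_rV R n @^-1` (F k `*` G k)) => [|k].
  rewrite eqEsubset; split => // v _.
  have [i _ Fi] : (\bigcup_i F i) (uncons_rV v).1 by rewrite -TF.
  have [j _ Gj] : (\bigcup_j G j) (uncons_rV v).2 by rewrite -TG.
  exists (maxn i j) => //; split.
  - by move: Fi; exact/subsetPset/ndF/leq_maxl.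
  - by move: Gj; exact/subsetPset/ndG/leq_maxr.
have [[mF Fk] [mG Gk]] := (Foo k, Goo k); split.
  rewrite -[X in measurable X]setTI; apply: measurable_uncons_rV => //.
  exact: measurableX.
rewrite /cons_measure /pushforward -comp_preimage.
rewrite (_ : _ \o _ = id) ?preimage_id; last exact/funext/cons_rVK.
by rewrite product_measure1E// lte_mul_pinfty// ge0_fin_numE.
Qed.

HB.instance Definition _ := Measure_isSigmaFinite.Build _ _ _ cons_measure
  cons_measure_sigma_finite.

End cons_measure.

(* Lebesgue measure on R^n, as the iterated product of that of R. *)
Fixpoint lebesgue_rV (R : realType) n :
    {sigma_finite_measure set 'rV[R]_n -> \bar R} :=
  if n is m.+1 then cons_measure (lebesgue_rV R m) else \d_(0 : 'rV[R]_0).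

Lemma measurable_box_rV (R : realType) n (A : 'I_n -> set R) :
  (forall i, measurable (A i)) ->
  measurable [set v : 'rV[R]_n | forall i, A i (v 0 i)].
Proof.
move=> mA; rewrite [X in measurable X](_ : _ =
    \bigcap_i ((fun v : 'rV[R]_n => v 0 i) @^-1` A i)).
  apply: fin_bigcap_measurable => [|i _]; first exact: finite_finset.
  rewrite -[X in measurable X]setTI; exact: measurable_coord_rV.
by rewrite eqEsubset; split => v Av i; [move=> _|]; exact: Av.
Qed.

Lemma lebesgue_rV_box (R : realType) n (A : 'I_n -> set R) :
  (forall i, measurable (A i)) ->
  (lebesgue_rV R n [set v | forall i, A i (v 0%R i)] =
   \prod_(i < n) @lebesgue_measure R (A i))%E.
Proof.
elim: n A => [|n ih] A mA.
  by rewrite big_ord0 /= diracE mem_set// => -[].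
rewrite big_ord_recl -ih; last by move=> i; exact: mA.
have mA' := @measurable_box_rV R n (A \o lift ord0) (fun i => mA _).
have /esym := product_measure1E (@lebesgue_measure R) (lebesgue_rV R n)
  (mA 0) mA'.
move=> ->.
rewrite /= /cons_measure /pushforward; congr (_ _).
rewrite eqEsubset; split => -[x v] /= Axv.
  split => [|i]; first by have := Axv 0; rewrite cons_rV0.
  by have := Axv (lift 0 i); rewrite cons_rVS.
move=> i; have [j ->|->] := unliftP 0 i; last by rewrite cons_rV0; case: Axv.
by rewrite cons_rVS; case: Axv.
Qed.

Section capacity.
Variables (R : realType) (n : nat).
Implicit Types (f : 'rV[R]_n -> R) (k : 'I_n) (K G : set 'rV[R]_n).

Definition unit_vec k : 'rV[R]_n := delta_mx 0 k.

Local Open Scope ereal_scope.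

Definition partial_modulus (p : R) f k (delta : R) : \bar R :=
  ereal_sup [set Lnorm (lebesgue_rV R n) p%:E
                   (fun x => (f (x + h *: unit_vec k) - f x)%:E)
            | h in `[0%R, delta]].

Definition besov_seminorm_dir (p q alpha : R) k f : \bar R :=
  (\int[@lebesgue_measure R]_(t in `]0%R, +oo[)
     (((t `^ (- alpha))%:E * partial_modulus p f k t) `^ q * (t^-1)%:E)) `^ q^-1.

Definition besov_seminorm p q alpha f : \bar R :=
  \sum_(k < n) besov_seminorm_dir p q alpha k f.

Local Close Scope ereal_scope.

(* C^oo: partial derivatives of all orders exist and are continuous; s lists
   the coordinates along which f is differentiated. *)
Definition iter_partial (s : seq 'I_n) f : 'rV[R]_n -> R :=
  foldr (fun k g x => 'D_(unit_vec k) g x) f s.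

Definition smooth f := forall s : seq 'I_n,
  continuous (iter_partial s f) /\
  forall k x, derivable (iter_partial s f) x (unit_vec k).

Definition compactly_supported f := compact (closure [set x | f x != 0]).

Definition admissible K : set ('rV[R]_n -> R) :=
  [set f | [/\ smooth f, compactly_supported f & forall x, K x -> 1 <= f x]].

(* Only meant for K compact. *)
Definition cap_compact p q alpha K : \bar R :=
  ereal_inf [set (besov_seminorm p q alpha f `^ p)%E | f in admissible K].

(* Only meant for G open. *)
Definition cap_open p q alpha G : \bar R :=
  ereal_sup [set cap_compact p q alpha K | K in [set K | compact K /\ K `<=` G]].

(* alpha^(p/q) cap(G; B^alpha_(p,q)) -> 2 n^p (1/q)^(p/q) |G| as alpha -> 0+;
   its negation includes the case where the limit does not exist. *)
Definition cap_limit_formula (p q : R) G :=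
  (fun alpha => (alpha `^ (p / q))%:E * cap_open p q alpha G)%E @ 0^'+ -->
  ((2 * n%:R `^ p * q^-1 `^ (p / q))%:E * lebesgue_rV R n G)%E.

End capacity.

(* Main.v *)
Require Import Defs.
From HB Require Import structures.
From mathcomp Require Import all_boot all_order all_algebra.
From mathcomp Require Import all_classical all_reals all_analysis.
From mathcomp Require Import measurable_realfun ring lra.

(** For alpha p < 1 the capacity of a set is not controlled by its measure:
    for each fixed such alpha there are open sets of arbitrarily small
    measure and arbitrarily large capacity ([large_capacity_small_measure]).
    Choosing such a set for every term of a sequence alpha_j decreasing to
    0, with capacity at least 1 / alpha_j and with measures of small sum,
    the union G of these sets has small measure and satisfies alpha_j cap(G)
    >= 1 for all j ([small_open_large_capacity]). This bounds the upper
    limit from below, and it contradicts the limit formula as soon as the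
    right-hand side of the formula, a fixed multiple of |G|, is smaller than
    1.

    The set for a fixed alpha consists of N thin cells of width eta = eps /
    N and with the unit cube as cross-section, placed along the first axis
    at distance 2^J eta from each other. Write beta = alpha p, let f be
    admissible for these cells, and let X be the p-th power of its seminorm.
    As the modulus of continuity is nondecreasing, the integral over [h, 2h]
    in the definition of the seminorm already gives, for every h > 0,
      int |f(x + h e) - f(x)|^p dx <= 2 (2h)^beta X
    ([integral_increment_le]), where e is the first coordinate vector.

    To contradict f >= 1 on the cells when X is bounded, f is averaged over
    the 2^j points x + i eta e, i < 2^j. These averages tend to 0 as j
    grows, because f is bounded with compact support, so that on the cells f
    is dominated, up to a small error, by the differences of averages at
    consecutive scales ([dyadic_telescope]). Such a difference is itself an
    average of increments of f with step 2^j eta, so that its p-th power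
    contributes 2^-j times the integral of the p-th power of the increments
    over the cells translated by i eta e, i < 2^j. For j <= J these
    translates are disjoint, so the contribution is of order 2^-j (2^j
    eta)^beta X; for j > J there is at most an additional factor N. As beta
    < 1, the scales j <= J sum up to a multiple of eta^beta X, which is
    small when N is large, and those with j > J are negligible once J is
    large with respect to N ([spaced_cells_energy]). But the total must
    exceed a constant times the total width N eta = eps, so X is large. *)

Set Implicit Arguments.
Unset Strict Implicit.
Unset Printing Implicit Defensive.
Import Order.TTheory GRing.Theory Num.Theory.
Import numFieldNormedType.Exports.

Local Open Scope classical_set_scope.
Local Open Scope ring_scope.

(** * Dyadic averages of a sequence *)

Section dyadic_average.
Variables (R : realType) (p : R).
Hypothesis p1 : 1 < p.
Implicit Types (u a : nat -> R) (j k J : nat).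

Lemma powR_convex_comb (t a b : R) : 0 <= t <= 1 -> 0 <= a -> 0 <= b ->
  (t * a + (1 - t) * b) `^ p <= t * a `^ p + (1 - t) * b `^ p.
Proof.
move=> /andP[t0 t1] a0 b0.
by apply: (convex_powR (ltW p1) (Itv01 t0 t1)); rewrite inE/= in_itv/= andbT.
Qed.

Lemma powR_midpoint (a b : R) :
  `|(a + b) / 2| `^ p <= (`|a| `^ p + `|b| `^ p) / 2.
Proof.
have h2 : 1 - 2^-1 = 2^-1 :> R by lra.
have t01 : 0 <= (2^-1 : R) <= 1 by lra.
have := powR_convex_comb t01 (normr_ge0 a) (normr_ge0 b).
rewrite h2 -!mulrDr ![2^-1 * _]mulrC; apply: le_trans.
apply: ge0_ler_powR; rewrite ?nnegrE ?normr_ge0 ?divr_ge0 ?addr_ge0//.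
  by rewrite ltW// (lt_trans _ p1).
by rewrite normrM (ger0_norm (_ : 0 <= 2^-1 :> R))// ler_wpM2r// ler_normD.
Qed.

(** Convexity of the power, applied to weights that favour the second term:
    its coefficient may be any number above 1. *)
Lemma powR_add_le (kap : R) : 1 < kap -> exists2 c : R, 0 <= c &
  forall a b : R, 0 <= a -> 0 <= b ->
    (a + b) `^ p <= c * a `^ p + kap * b `^ p.
Proof.
move=> kap1; have p0 : 0 < p by rewrite (lt_trans _ p1).
have q0 : 0 < p - 1 by rewrite subr_gt0.
(* the weight t of the second term is chosen so that t^(1 - p) = kap *)
pose t := kap `^ (- (p - 1)^-1).
have k0 : 0 < kap by rewrite (lt_trans _ kap1).
have t0 : 0 < t by exact: powR_gt0.
have t1 : t < 1.
  rewrite /t powRN invf_lt1 ?powR_gt0// -[X in X < _](@powRr0 R kap).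
  rewrite /powR (gt_eqF k0) ltr_expR mul0r mulr_gt0 ?invr_gt0//.
  exact: ln_gt0.
have s0 : 0 < 1 - t by rewrite subr_gt0.
exists ((1 - t) * (1 - t)^-1 `^ p); first by rewrite mulr_ge0 ?powR_ge0// ltW.
move=> a b a0 b0.
have tkap : t * t^-1 `^ p = kap.
  rewrite -{1}(@powRr1 _ t (ltW t0)) -[t^-1]powR_inv1 ?(ltW t0)// -powRrM.
  rewrite -powRD; last by rewrite (gt_eqF t0) implybT.
  rewrite /t -powRrM (_ : _ * _ = 1) ?powRr1 ?(ltW k0)//.
  by field; rewrite gt_eqF.
have -> : a + b = (1 - t) * ((1 - t)^-1 * a) + (1 - (1 - t)) * (t^-1 * b).
  by field; rewrite !gt_eqF.
apply: le_trans (powR_convex_comb _ _ _) _.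
- by rewrite (ltW s0)/= gerBl ltW.
- by rewrite mulr_ge0// invr_ge0 ltW.
- by rewrite mulr_ge0// invr_ge0 ltW.
rewrite !powRM ?invr_ge0 ?(ltW t0) ?(ltW s0)//.
by rewrite (_ : 1 - (1 - t) = t) ?mulrA ?tkap//; ring.
Qed.

Lemma powR_sum_le (kap : R) : 1 < kap -> exists2 c : R, 0 <= c &
  forall a J, (forall j, 0 <= a j) ->
    (\sum_(j < J) a j) `^ p <= c * \sum_(j < J) kap ^+ j * a j `^ p.
Proof.
move=> /[dup] kap1 /powR_add_le[c c0 cP]; exists c => // a J.
elim: J a => [|J ih] a a0.
  by rewrite !big_ord0 mulr0 powR0// gt_eqF// (lt_trans _ p1).
rewrite !big_ord_recl expr0 mul1r mulrDr.
apply: (le_trans (cP _ _ _ _)) => //; first by apply: sumr_ge0.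
rewrite lerD2l; have k0 : 0 <= kap by rewrite ltW// (lt_trans _ kap1).
apply: (le_trans (ler_wpM2l k0 (ih (fun j => a j.+1) _))) => //.
rewrite mulrCA ler_wpM2l// mulr_sumr.
by under eq_bigr do rewrite mulrA -exprS.
Qed.

(** The average of u over the 2^j consecutive indices k, ..., k + 2^j - 1. *)
Fixpoint dyadic_avg u j k : R :=
  if j is j'.+1 then (dyadic_avg u j' k + dyadic_avg u j' (k + 2 ^ j')) / 2
  else u k.

Lemma dyadic_avgB u j k (d : nat) :
  dyadic_avg u j k - dyadic_avg u j (k + d) =
  dyadic_avg (fun i => u i - u (i + d)%N) j k.
Proof.
elim: j k => [//|j ih] k /=; rewrite -!ih.
by rewrite addnAC; field.
Qed.

Lemma dyadic_avgE u j k :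
  dyadic_avg u j k = (2 ^+ j)^-1 * \sum_(i < 2 ^ j) u (k + i)%N.
Proof.
elim: j k => [|j ih] k.
  by rewrite /= expr0 invr1 mul1r big_ord1 addn0.
rewrite (_ : (2 ^ j.+1)%N = (2 ^ j + 2 ^ j)%N); last first.
  by rewrite expnS mul2n addnn.
rewrite big_split_ord/= !ih exprS.
under [X in _ + _^-1 * X]eq_bigr do rewrite -addnA.
by field; rewrite expf_neq0.
Qed.

Lemma dyadic_avg_powR u j k :
  `|dyadic_avg u j k| `^ p <=
  (2 ^+ j)^-1 * \sum_(i < 2 ^ j) `|u (k + i)%N| `^ p.
Proof.
rewrite -(dyadic_avgE (fun i => `|u i| `^ p)).
elim: j k => [//|j ih] k /=.
apply: (le_trans (powR_midpoint _ _)).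
by rewrite ler_wpM2r// lerD.
Qed.

(** A bounded sequence with finite support has small averages at large
    scales. *)
Lemma dyadic_avg_le u (B : R) (n0 : nat) j k : (forall i, `|u i| <= B) ->
  (forall i, (n0 <= i)%N -> u i = 0) ->
  dyadic_avg u j k <= (2 ^+ j)^-1 * (B * n0%:R).
Proof.
move=> uB u0; rewrite dyadic_avgE ler_wpM2l ?invr_ge0 ?exprn_ge0//.
have B0 : 0 <= B := le_trans (normr_ge0 (u 0%N)) (uB 0%N).
suff: \sum_(i < 2 ^ j) u (k + i)%N <= B * (minn (2 ^ j) n0)%:R.
  by move=> /le_trans; apply; rewrite ler_wpM2l// ler_nat geq_minr.
elim: (2 ^ j)%N => [|m ih]; first by rewrite big_ord0 min0n mulr0.
rewrite big_ord_recr/=; have [mn|nm] := ltnP m n0.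
  rewrite (minn_idPl mn) -natr1 mulrDr mulr1.
  move: ih; rewrite (minn_idPl (ltnW mn)) => ih.
  by rewrite lerD// (le_trans (ler_norm _)).
rewrite u0 ?addr0; last by rewrite (leq_trans nm)// leq_addl.
by move: ih; rewrite (minn_idPr nm) (minn_idPr (leqW nm)).
Qed.

(** Telescoping over the scales controls a sequence up to its large-scale
    averages by its increments along powers of 2 only. *)
Lemma dyadic_telescope (kap : R) : 1 < kap -> exists2 c : R, 0 <= c &
  forall u J k, `|u k - dyadic_avg u J k| `^ p <=
    c * \sum_(j < J) kap ^+ j * ((2 ^+ j)^-1 *
      \sum_(i < 2 ^ j) `|u (k + i)%N - u (k + i + 2 ^ j)%N| `^ p).
Proof.
move=> /[dup] kap1 /powR_sum_le[c c0 cP]; exists c => // u J k.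
have p0 : 0 <= p by rewrite ltW// (lt_trans _ p1).
pose a j := `|dyadic_avg u j k - dyadic_avg u j.+1 k|.
have au : `|u k - dyadic_avg u J k| <= \sum_(j < J) a j.
  elim: J => [|J ih]; first by rewrite /= subrr normr0 big_ord0.
  rewrite big_ord_recr/=; apply: le_trans (lerD ih (lexx _)).
  by apply: le_trans (ler_normD _ _); rewrite addrA subrK.
apply: (@le_trans _ _ ((\sum_(j < J) a j) `^ p)).
  apply: ge0_ler_powR => //.
  by rewrite nnegrE sumr_ge0// => j _; exact: normr_ge0.
apply: le_trans (cP a J (fun j => normr_ge0 _)) _.
rewrite ler_wpM2l//; apply: ler_sum => j _.
rewrite ler_wpM2l ?exprn_ge0 ?(ltW (lt_trans ltr01 kap1))//.
apply: le_trans (dyadic_avg_powR (fun i => u i - u (i + 2 ^ j)%N) j k).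
rewrite -dyadic_avgB; apply: ge0_ler_powR => //; first exact: normr_ge0.
rewrite /a /=; set x := dyadic_avg u j k; set y := dyadic_avg u j (k + 2 ^ j).
rewrite (_ : x - (x + y) / 2 = (x - y) / 2); last by field.
by rewrite normrM (ger0_norm (_ : 0 <= 2^-1 :> R))// ler_piMr//; lra.
Qed.

End dyadic_average.

(** * Lebesgue measure on the space and translations along the first axis *)

Section first_axis.
Variables (R : realType) (n : nat).
Implicit Types (h : R) (A B : set R).

Local Notation e0 := (unit_vec R (ord0 : 'I_n.+1)).
Local Notation mu := (lebesgue_rV R n.+1).

Lemma shift_unit_vec0 h (v : 'rV[R]_n.+1) : (v + h *: e0) 0 0 = v 0 0 + h.
Proof. by rewrite !mxE !eqxx mulr1. Qed.

Lemma shift_unit_vecS h (v : 'rV[R]_n.+1) i :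
  (v + h *: e0) 0 (lift ord0 i) = v 0 (lift ord0 i).
Proof. by rewrite !mxE /= mulr0 addr0. Qed.

Lemma cons_rV_shift h (u : R * 'rV[R]_n) :
  cons_rV u + h *: e0 = cons_rV (u.1 + h, u.2).
Proof.
apply/rowP => i; have [j ->|->] := unliftP ord0 i.
  by rewrite shift_unit_vecS !cons_rVS.
by rewrite shift_unit_vec0 !cons_rV0.
Qed.

Lemma measurable_shift_unit_vec h :
  measurable_fun [set: 'rV[R]_n.+1] (fun v => v + h *: e0).
Proof.
apply: measurable_fun_rVP => i.
under eq_fun do rewrite mxE.
by apply: measurable_funD; [exact: measurable_coord_rV|exact: measurable_cst].
Qed.

Lemma measurable_continuous_rV (f : 'rV[R]_n.+1 -> R) :
  continuous f -> measurable_fun [set: 'rV[R]_n.+1] f.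
Proof.
move=> cf; apply: (measurability _ (RGenOpens.measurableE R)).
move=> _ [_ [a [b ->]] <-]; rewrite setTI; apply: measurable_open_rV.
apply: open_comp; first by move=> v _; exact: cf.
exact: interval_open.
Qed.

Lemma lebesgue_measure_shift h (A : set (measurableTypeR R)) : measurable A ->
  lebesgue_measure
    ((fun x : measurableTypeR R => x + h : measurableTypeR R) @^-1` A) =
  lebesgue_measure A.
Proof.
move=> mA.
pose s (x : measurableTypeR R) : measurableTypeR R := x + h.
have ms : measurable_fun [set: measurableTypeR R] s by exact: measurable_funD.
pose ss : {mfun measurableTypeR R >-> measurableTypeR R} :=
  HB.pack s (isMeasurableFun.Build _ _ _ _ _ ms).
apply/esym.
apply: (@lebesgue_measure_unique R (pushforward lebesgue_measure ss)) => //.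
move=> _ [[a b]] _ <-.
transitivity (lebesgue_measure `](a - h), (b - h)]%classic); last first.
  congr (lebesgue_measure _).
  by apply/seteqP; split => x /=; rewrite /set_itvoc/= !in_itv/= /s; lra.
rewrite !lebesgue_measure_itv/= !lte_fin ltrD2r.
by rewrite -!EFinD opprD opprK addrACA addNr addr0.
Qed.

Lemma lebesgue_rV_shift h (A : set 'rV[R]_n.+1) : measurable A ->
  mu ((fun v => v + h *: e0) @^-1` A) = mu A.
Proof.
move=> mA; rewrite /= /cons_measure /pushforward /= /product_measure1.
have mB : measurable (@cons_rV R n @^-1` A).
  by rewrite -[X in measurable X]setTI; exact: measurable_cons_rV.
set B := @cons_rV R n @^-1` A.
pose s (x : measurableTypeR R) : measurableTypeR R := x + h.
have ms : measurable_fun [set: measurableTypeR R] s by exact: measurable_funD.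
transitivity (\int[pushforward lebesgue_measure s]_x
    (lebesgue_rV R n (xsection B x)))%E; last first.
  apply: eq_measure_integral => C mC _.
  exact: lebesgue_measure_shift.
rewrite ge0_integral_pushforward//; last exact: measurable_fun_xsection.
rewrite preimage_setT; apply: eq_integral => x _ /=; congr (lebesgue_rV R n _).
apply/seteqP; split => y; rewrite /xsection/= !inE /B/=.
  by rewrite cons_rV_shift.
by rewrite cons_rV_shift.
Qed.

Lemma ge0_integral_shift h (D : set 'rV[R]_n.+1) (g : 'rV[R]_n.+1 -> \bar R) :
  measurable D -> measurable_fun [set: 'rV[R]_n.+1] g ->
  (forall v, 0 <= g v)%E ->
  (\int[mu]_(v in (fun v => v + h *: e0)%R @^-1` D) g (v + h *: e0)%R =
   \int[mu]_(v in D) g v)%E.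
Proof.
move=> mD mg g0.
pose T (v : 'rV[R]_n.+1) := v + h *: e0.
have mT : measurable_fun [set: 'rV[R]_n.+1] T := measurable_shift_unit_vec h.
transitivity (\int[pushforward mu T]_(v in D) g v)%E.
  apply/esym; apply: ge0_integral_pushforward => //.
  exact: measurable_funTS.
by apply: eq_measure_integral => C mC _; exact: (lebesgue_rV_shift h mC).
Qed.

(** The points with first coordinate in A and all other coordinates in B. *)
Definition prism A B : set 'rV[R]_n.+1 :=
  [set v | A (v 0 0) /\ forall i, B (v 0 (lift ord0 i))].

Lemma prismE A B :
  prism A B = [set v | forall i, (if i == ord0 then A else B) (v 0 i)].
Proof.
apply/seteqP; split => [v [Av Bv] i|v Pv] /=.
  by have [j ->|->] := unliftP ord0 i.
by split => [|i]; [exact: (Pv ord0)|exact: (Pv (lift ord0 i))].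
Qed.

Lemma measurable_prism A B :
  measurable A -> measurable B -> measurable (prism A B).
Proof.
move=> mA mB; rewrite prismE.
apply: (@measurable_box_rV R n.+1 (fun i => if i == ord0 then A else B)) => i.
by case: ifP.
Qed.

Lemma lebesgue_rV_prism A B : measurable A -> measurable B ->
  (mu (prism A B) = lebesgue_measure A * \prod_(i < n) lebesgue_measure B)%E.
Proof.
move=> mA mB; rewrite prismE.
rewrite (@lebesgue_rV_box R n.+1 (fun i => if i == ord0 then A else B)).
  by rewrite big_ord_recl.
by move=> i; case: ifP.
Qed.

(** The cell of width eta at the k-th place along the first axis, with the unit
    cube as cross-section. *)
Definition cell (eta : R) (k : nat) : set 'rV[R]_n.+1 :=
  prism `[k%:R * eta, k.+1%:R * eta[%classic `[0, 1]%classic.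

Lemma measurable_cell eta k : measurable (cell eta k).
Proof. exact: measurable_prism. Qed.

Lemma lebesgue_rV_cell eta : 0 < eta -> mu (cell eta 0) = eta%:E.
Proof.
move=> eta0; rewrite lebesgue_rV_prism//.
rewrite big1 => [|i _]; last first.
  by rewrite lebesgue_measure_itv/= lte01 oppr0 adde0.
by rewrite lebesgue_measure_itv/= mul0r mul1r lte_fin eta0 oppr0 adde0 mule1.
Qed.

Lemma cell_shift eta k :
  (fun v => v + (k%:R * eta) *: e0) @^-1` cell eta k = cell eta 0.
Proof.
apply/seteqP; split => v; rewrite /cell/= /prism/= => -[].
  rewrite shift_unit_vec0 => H vB; split.
    by move: H; rewrite !in_itv/= -natr1 mulrDl; lra.
  by move=> i; have := vB i; rewrite shift_unit_vecS.
move=> H vB; split.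
  by move: H; rewrite shift_unit_vec0 !in_itv/= -natr1 mulrDl; lra.
by move=> i; rewrite shift_unit_vecS.
Qed.

Lemma trivIset_cell eta : 0 < eta -> trivIset [set: nat] (cell eta).
Proof.
move=> eta0; apply/trivIsetP => i j _ _.
wlog ij : i j / (i < j)%N => [wl|_].
  rewrite neq_ltn => /orP[ij|ji]; [|rewrite setIC]; apply: wl => //;
  by rewrite ?(ltn_eqF ij)// ?(ltn_eqF ji).
rewrite -subset0 => v [] [] /=; rewrite !in_itv/=.
move=> /andP[_ vi] _ [/andP[jv _] _].
have : (i.+1%:R * eta <= j%:R * eta) by rewrite ler_pM2r// ler_nat.
by move=> /(lt_le_trans vi) /lt_le_trans /(_ jv); rewrite ltxx.
Qed.

(** Translates of the initial cell by distinct multiples of its width do not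
    overlap, so that integrals over them add up to at most the full one. *)
Lemma sum_integral_cell_le eta m (g : 'rV[R]_n.+1 -> \bar R) : 0 < eta ->
  measurable_fun [set: 'rV[R]_n.+1] g -> (forall v, 0 <= g v)%E ->
  (\sum_(k < m) \int[mu]_(v in cell eta 0) g (v + (k%:R * eta) *: e0)%R <=
   \int[mu]_v g v)%E.
Proof.
move=> eta0 mg g0.
under eq_bigr => k _.
  rewrite -(cell_shift eta k) ge0_integral_shift//; last exact: measurable_cell.
  over.
rewrite -(big_mkord xpredT (fun k => \int[mu]_(v in cell eta k) g v)%E).
rewrite /index_iota subn0.
rewrite -ge0_integral_bigsetU//=; first last.
- exact: measurable_funTS.
- by apply: sub_trivIset (trivIset_cell eta0).
- exact: iota_uniq.
- by move=> k; exact: measurable_cell.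
apply: ge0_subset_integral => //.
by apply: bigsetU_measurable => k _; exact: measurable_cell.
Qed.

End first_axis.

(** * Increments are controlled by the seminorm *)

Section increments.
Import HBNNSimple.
Local Open Scope ereal_scope.

(** The upper function need not be measurable: both integrals are suprema over
    simple functions. *)
Lemma ge0_le_integral_sup d (T : measurableType d) (R : realType)
    (m : {measure set T -> \bar R}) (D : set T) (f g : T -> \bar R) :
  (forall x, D x -> 0 <= f x) -> (forall x, D x -> f x <= g x) ->
  \int[m]_(x in D) f x <= \int[m]_(x in D) g x.
Proof.
move=> f0 fg; rewrite !ge0_integralE//; last first.
  by move=> x Dx; exact: le_trans (f0 _ Dx) (fg _ Dx).
apply: ereal_sup_le => _ [h hf <-].
exists h => // x.
by apply: le_trans (hf x) _; apply: lee_restrict.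
Qed.

Variables (R : realType) (n : nat) (p alpha : R).
Hypotheses (p1 : (1 < p)%R) (alpha0 : (0 < alpha)%R).
Implicit Type f : 'rV[R]_n.+1 -> R.

Local Notation e0 := (unit_vec R (ord0 : 'I_n.+1)).
Local Notation mu := (lebesgue_rV R n.+1).

Lemma besov_seminorm_ge_dir f (k : 'I_n.+1) :
  besov_seminorm_dir p p alpha k f <= besov_seminorm p p alpha f.
Proof.
rewrite /besov_seminorm (bigD1 k)//= leeDl// sume_ge0// => i _.
exact: poweR_ge0.
Qed.

Lemma besov_seminorm_powR_ge_dir f :
  \int[@lebesgue_measure R]_(t in `]0%R, +oo[)
     (((t `^ (- alpha))%:E * partial_modulus p f ord0 t) `^ p * (t^-1)%:E) <=
  besov_seminorm p p alpha f `^ p.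
Proof.
have p0 : (0 < p)%R by rewrite (lt_trans _ p1).
set I := \int[_]_(t in _) _.
have I0 : 0 <= I.
  apply: integral_ge0 => t /=; rewrite in_itv/= andbT => t0.
  by rewrite mule_ge0 ?poweR_ge0// lee_fin invr_ge0 ltW.
rewrite -[leLHS]poweRe1// -(mulVf (lt0r_neq0 p0)) poweRrM.
apply: gt0_ler_poweR; rewrite ?(ltW p0)// ?in_itv/= ?leey ?andbT.
- exact: poweR_ge0.
- by apply: sume_ge0 => k _; exact: poweR_ge0.
- exact: (besov_seminorm_ge_dir f ord0).
Qed.

Lemma partial_modulus_ge f (k : 'I_n.+1) (h t : R) : (0 <= h <= t)%R ->
  Lnorm mu p%:E (fun x => (f (x + h *: unit_vec R k)%R - f x)%:E) <=
  partial_modulus p f k t.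
Proof. by move=> ht; apply: ereal_sup_ubound; exists h. Qed.

(** The modulus of continuity at any t in [h, 2h] is at least the norm of the
    increment of step h, so the part of the seminorm over [h, 2h] suffices. *)
Lemma integral_increment_le f (h : R) : (0 < h)%R ->
  \int[mu]_x (`|f (x + h *: e0) - f x| `^ p)%:E <=
  (2 * (2 * h) `^ (alpha * p))%:E * besov_seminorm p p alpha f `^ p.
Proof.
move=> h0; have p0 : (0 < p)%R by rewrite (lt_trans _ p1).
set N := Lnorm mu p%:E (fun x => (f (x + h *: e0)%R - f x)%:E).
have -> : \int[mu]_x (`|f (x + h *: e0) - f x| `^ p)%:E = N `^ p.
  by rewrite /N powR_Lnorm ?gt_eqF.
have N0 : 0 <= N by exact: Lnorm_ge0.
have h20 : (0 < 2 * h)%R by rewrite mulr_gt0.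
set c := (2 * (2 * h) `^ (alpha * p))%R.
have c0 : (0 < c)%R by rewrite mulr_gt0// powR_gt0.
have cE : (c = (((2 * h) `^ (- alpha)) `^ p * (2 * h)^-1 * h)^-1)%R.
  rewrite /c -powRrM mulNr powRN.
  by field; rewrite !gt_eqF// powR_gt0.
suff : (c^-1)%:E * N `^ p <= besov_seminorm p p alpha f `^ p.
  by rewrite lee_pdivrMl.
apply: le_trans (besov_seminorm_powR_ge_dir f).
pose K := (((2 * h) `^ (- alpha))%:E * N) `^ p * ((2 * h)^-1)%:E.
have K0 : 0 <= K by rewrite mule_ge0 ?poweR_ge0// lee_fin invr_ge0 ltW.
apply: (@le_trans _ _ (\int[@lebesgue_measure R]_(t in `]0%R, +oo[)
    (cst K \_ `[h, (2 * h)%R]) t)).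
  rewrite -integral_mkcondr setIidr; last first.
    move=> t /=; rewrite !in_itv/= andbT => /andP[ht _].
    exact: lt_le_trans ht.
  rewrite integral_cst//= lebesgue_measure_itv/= lte_fin.
  rewrite ltr_pMl// ltr1n -EFinB (_ : (2 * h - h = h)%R); last by ring.
  rewrite /K poweRM// ?lee_fin ?powR_ge0// poweR_EFin cE invrK.
  by rewrite !EFinM (muleAC _ (N `^ p)) (muleAC _ (N `^ p)).
apply: ge0_le_integral_sup => t /=; rewrite in_itv/= andbT => t0.
  by rewrite patchE; case: ifP.
rewrite patchE; case: ifPn; last first.
  by move=> _; rewrite mule_ge0 ?poweR_ge0// lee_fin invr_ge0 ltW.
rewrite inE/= in_itv/= => /andP[ht th]; apply: lee_pmul.
- exact: poweR_ge0.
- by rewrite lee_fin invr_ge0 ltW.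
- apply: gt0_ler_poweR; rewrite ?(ltW p0)// ?in_itv/= ?leey ?andbT.
  + by rewrite mule_ge0// lee_fin powR_ge0.
  + rewrite mule_ge0// ?lee_fin ?powR_ge0// (le_trans N0)//.
    by rewrite partial_modulus_ge// (ltW h0).
  apply: lee_pmul => //; first by rewrite lee_fin powR_ge0.
    rewrite lee_fin !powRN lef_pV2 ?posrE ?powR_gt0//.
    by apply: ge0_ler_powR; rewrite ?nnegrE ?(ltW alpha0) ?(ltW t0) ?(ltW h20).
  by rewrite partial_modulus_ge// (ltW h0).
- by rewrite lee_fin lef_pV2 ?posrE.
Qed.

End increments.

(** * The energy needed to exceed 1 on widely spaced cells *)

(** Consecutive windows of length d, starting at multiples of D >= d, are
    disjoint; windows of any length overlap at most N times if there are N of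
    them. *)
Section windows.
Local Open Scope ereal_scope.
Variables (R : realType) (G : nat -> \bar R) (E : \bar R).
Hypotheses (G0 : forall k, 0 <= G k) (GE : forall m, \sum_(k < m) G k <= E).

Lemma sum_windows_disjoint (N D d : nat) : (d <= D)%N ->
  \sum_(m < N) \sum_(i < d) G (m * D + i)%N <= E.
Proof.
move=> dD; apply: le_trans (GE (N * D)).
elim: N => [|N ih]; first by rewrite mul0n !big_ord0.
rewrite mulSnr big_split_ord/= big_ord_recr/=; apply: leeD => //.
by rewrite -(subnKC dD) big_split_ord/= leeDl// sume_ge0.
Qed.

Lemma sum_windows_le (N D d : nat) :
  \sum_(m < N) \sum_(i < d) G (m * D + i)%N <= N%:R%:E * E.
Proof.
elim: N => [|N ih]; first by rewrite big_ord0 mul0e.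
rewrite big_ord_recr/= -natr1 EFinD ge0_muleDl ?lee_fin// mul1e.
apply: leeD => //.
apply: le_trans (GE (N * D + d)).
by rewrite big_split_ord/= leeDr// sume_ge0.
Qed.

End windows.

Section spaced_cells.
Variables (R : realType) (n : nat).
Implicit Type f : 'rV[R]_n.+1 -> R.

Local Notation e0 := (unit_vec R (ord0 : 'I_n.+1)).
Local Notation mu := (lebesgue_rV R n.+1).

Lemma compactly_supported_bounded f : continuous f -> compactly_supported f ->
  exists B : R, forall v, `|f v| <= B.
Proof.
move=> cf csf.
have : compact (f @` closure [set x | f x != 0]).
  by apply: continuous_compact => //; exact: continuous_subspaceT.
move=> /compact_bounded[M [_ MP]]; exists (Num.max (M + 1) 0) => v.
have [->|fv0] := eqVneq (f v) 0; first by rewrite normr0 le_max lexx orbT.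
rewrite le_max MP ?ltrDl//; exists v => //.
exact: subset_closure.
Qed.

Lemma compactly_supported_half_space f : compactly_supported f ->
  exists r : R, forall v : 'rV[R]_n.+1, r <= v 0 0 -> f v = 0.
Proof.
move=> csf.
have : compact ((fun v : 'rV[R]_n.+1 => v 0 0) @` closure [set x | f x != 0]).
  apply: continuous_compact => //; apply: continuous_subspaceT => v.
  exact: coord_continuous.
move=> /compact_bounded[M [_ MP]]; exists (M + 2) => v rv.
apply/eqP/negPn/negP => fv0.
have : `|v 0 0| <= M + 1.
  by apply: MP; rewrite ?ltrDl//; exists v => //; exact: subset_closure.
by move=> /(le_trans (ler_norm _)); lra.
Qed.

(** Along the first axis, the values of f at the points v + k eta e0, where v
    ranges over the initial cell, are small in average at a large enough scale,
    uniformly in v. *)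
Lemma dyadic_avg_small f (eta : R) : continuous f -> compactly_supported f ->
  0 < eta -> exists J, forall v, cell eta 0 v -> forall k,
    dyadic_avg (fun k => f (v + (k%:R * eta) *: e0)) J k <= 2^-1.
Proof.
move=> cf csf eta0.
have [B fB] := compactly_supported_bounded cf csf.
have [r fr] := compactly_supported_half_space csf.
have B0 : 0 <= B := le_trans (normr_ge0 (f 0)) (fB 0).
pose n0 := (Num.truncn `|r / eta|).+1.
pose J := (Num.truncn (2 * (B * n0%:R))).+1.
exists J => v vcell k.
have {vcell}v0 : 0 <= v 0 0.
  by case: vcell; rewrite /= in_itv/= mul0r => /andP[].
apply: (le_trans (dyadic_avg_le (B := B) (n0 := n0) _ _ _ _)) => // [i n0i|].
  apply: fr; rewrite shift_unit_vec0.
  have : r / eta < i%:R.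
    apply: (le_lt_trans (ler_norm _)); apply: (lt_le_trans (truncnS_gt _)).
    by rewrite ler_nat.
  rewrite ltr_pdivrMr// => /ltW /le_trans; apply.
  by rewrite lerDr.
rewrite mulrC ler_pdivrMr ?exprn_gt0//.
rewrite [leRHS]mulrC ler_pdivlMr// mulrC.
apply: (le_trans (ltW (truncnS_gt _))).
by rewrite -natrX ler_nat ltnW// ltn_expl.
Qed.

Lemma measurable_increment f (p h : R) : continuous f ->
  measurable_fun [set: 'rV[R]_n.+1] (fun v => `|f (v + h *: e0) - f v| `^ p).
Proof.
move=> cf; have mf := measurable_continuous_rV cf.
apply: (measurableT_comp (measurable_powR p)).
apply: measurableT_comp => //; apply: measurable_funB => //.
exact: measurableT_comp mf (measurable_shift_unit_vec h).
Qed.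

(** If f is at least 1 on N cells spaced by D eta, then the total width of these
    cells is at most a weighted sum, over the scales j, of the integrals of the
    increments of step 2^j eta over windows of 2^j consecutive cells. *)
Lemma sum_increments_ge (p : R) (kap : R) : 1 < p -> 1 < kap ->
  exists2 c : R, 0 <= c & forall f (eta : R) (N D : nat),
  continuous f -> compactly_supported f -> 0 < eta ->
  (forall m v, (m < N)%N -> cell eta (m * D) v -> 1 <= f v) ->
  exists J, ((N%:R * eta)%:E <= \sum_(j < J) (c * (kap / 2) ^+ j)%:E *
    \sum_(m < N) \sum_(i < 2 ^ j) \int[mu]_(v in cell eta 0)
      (`|f (v + ((m * D + i)%:R * eta) *: e0 + (2 ^+ j * eta) *: e0) -
         f (v + ((m * D + i)%:R * eta) *: e0)| `^ p)%:E)%E.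
Proof.
move=> p1 kap1; have [c c0 cP] := dyadic_telescope p1 kap1.
have p0 : 0 < p by rewrite (lt_trans _ p1).
have kap0 : 0 <= kap by rewrite ltW// (lt_trans _ kap1).
exists (2 `^ p * c) => [|f eta N D cf csf eta0 f1].
  by rewrite mulr_ge0// powR_ge0.
have [J JP] := dyadic_avg_small cf csf eta0; exists J.
pose g j (v : 'rV[R]_n.+1) := `|f (v + (2 ^+ j * eta) *: e0) - f v| `^ p.
have mg j k : measurable_fun [set: 'rV[R]_n.+1]
    (fun v => (g j (v + (k%:R * eta) *: e0))%:E).
  apply/measurable_EFinP; apply: measurableT_comp (measurable_shift_unit_vec _).
  exact: measurable_increment.
have g0 j v : (0 <= (g j v)%:E)%E by rewrite lee_fin powR_ge0.
(* the estimate at a single point *)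
have pointwise m v : (m < N)%N -> cell eta 0 v ->
    1 <= \sum_(j < J) (2 `^ p * c * (kap / 2) ^+ j) *
      \sum_(i < 2 ^ j) g j (v + ((m * D + i)%:R * eta) *: e0).
  move=> mN v0; pose u k := f (v + (k%:R * eta) *: e0).
  have um1 : 1 <= u (m * D)%N.
    apply: (f1 m) => //; move: v0.
    by rewrite -(cell_shift n eta (m * D)).
  have h2 : 2^-1 <= `|u (m * D)%N - dyadic_avg u J (m * D)|.
    apply: le_trans (ler_norm _).
    by have := JP v v0 (m * D)%N; rewrite -/u; lra.
  rewrite [leLHS](_ : 1 = 2 `^ p * 2^-1 `^ p); last first.
    by rewrite -powRM// mulfV// powR1.
  under eq_bigr do rewrite -mulrA -mulrA.
  rewrite -mulr_sumr ler_pM2l ?powR_gt0//.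
  apply: (le_trans _ (le_trans (cP u J (m * D)%N) _)).
    by apply: ge0_ler_powR => //; rewrite ?nnegrE ?(ltW p0).
  rewrite mulr_sumr; apply: ler_sum => j _.
  rewrite expr_div_n mulrA -!mulrA; do 2 (apply: ler_wpM2l => //).
    by rewrite exprn_ge0.
  apply: ler_wpM2l; first by rewrite invr_ge0 exprn_ge0.
  apply: ler_sum => i _; rewrite distrC /g /u -addrA -scalerDl -mulrDl.
  by rewrite natrD natrX.
(* integration over the initial cell *)
have cellwise m : (m < N)%N -> (eta%:E <= \sum_(j < J)
    (2 `^ p * c * (kap / 2) ^+ j)%:E *
    \sum_(i < 2 ^ j) \int[mu]_(v in cell eta 0)
      (g j (v + ((m * D + i)%:R * eta) *: e0))%:E)%E.
  move=> mN; rewrite -[X in (X <= _)%E](lebesgue_rV_cell n eta0).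
  rewrite -[X in (X <= _)%E]mul1e -integral_cst; last exact: measurable_cell.
  have w0 j : (0 <= (2 `^ p * c * (kap / 2) ^+ j)%:E)%E.
    by rewrite lee_fin !mulr_ge0 ?powR_ge0 ?exprn_ge0 ?divr_ge0.
  under eq_bigr => j _.
    rewrite -ge0_integral_sum//; last 2 first.
    - exact: measurable_cell.
    - by move=> i; exact: measurable_funTS.
    rewrite -ge0_integralZl//; last 3 first.
    - exact: measurable_cell.
    - by apply: emeasurable_sum => i; exact: measurable_funTS.
    - by move=> v _; apply: sume_ge0 => i _.
    over.
  rewrite -ge0_integral_sum//; last 3 first.
  - exact: measurable_cell.
  - move=> j; apply: measurable_funeM; apply: emeasurable_sum => i.
    exact: measurable_funTS.
  - by move=> j v _; rewrite mule_ge0// sume_ge0.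
  apply: ge0_le_integral_sup => // v v0.
  under eq_bigr do rewrite sumEFin -EFinM.
  by rewrite sumEFin lee_fin pointwise.
have -> : ((N%:R * eta)%:E = \sum_(m < N) eta%:E)%E.
  by rewrite sumEFin sumr_const card_ord mulr_natl.
apply: (le_trans (lee_sum _ (fun (m : 'I_N) _ => cellwise m (ltn_ord m)))).
rewrite exchange_big/=; apply: lee_sum => j _.
rewrite ge0_sume_distrr// => m _; apply: sume_ge0 => i _.
by apply: integral_ge0 => v _.
Qed.

End spaced_cells.

Lemma powR_expn (R : realType) (a b : R) j : 0 <= a ->
  (a ^+ j) `^ b = (a `^ b) ^+ j.
Proof.
by move=> a0; elim: j => [|j ih]; rewrite ?powR1// !exprS powRM ?exprn_ge0// ih.
Qed.

(** The lower bound for the constant A in a Hoelder-type estimate of exponent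
    beta < 1 for the increments of f: since the condition on N and J makes the
    overlaps of the windows harmless, A behaves as if the N cells were
    independent of each other. *)
Lemma spaced_cells_energy (R : realType) (n : nat) (p beta : R) :
  1 < p -> 0 < beta -> beta < 1 ->
  exists C s : R, [/\ 0 <= C, 0 < s, s < 1 &
    forall (f : 'rV[R]_n.+1 -> R) (A eta : R) (N J : nat),
    continuous f -> compactly_supported f -> 0 <= A -> 0 < eta ->
    (forall h, 0 < h ->
      (\int[lebesgue_rV R n.+1]_v
        (`|f (v + h *: unit_vec R ord0) - f v| `^ p)%:E <=
       (A * h `^ beta)%:E)%E) ->
    (forall m v, (m < N)%N -> cell eta (m * 2 ^ J) v -> 1 <= f v) ->
    N%:R * s ^+ J <= 1 ->
    N%:R * eta <= C * A * eta `^ beta].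
Proof.
move=> p1 b0 b1.
(* sig^3 = 2^(1 - beta): one factor sig is lost in the telescoping, one pays
   for the overlaps and the last one makes the sum over the scales converge *)
pose sig : R := 2 `^ ((1 - beta) / 3).
have sig1 : 1 < sig.
  have e0 : 0 < (1 - beta) / 3 by rewrite divr_gt0// subr_gt0.
  have := @gt0_ltr_powR R _ e0 1 2; rewrite powR1 => ->//; rewrite ?nnegrE//.
  by rewrite ltr1n.
have sig0 : 0 < sig by rewrite (lt_trans _ sig1).
have sigE : sig / 2 * 2 `^ beta = sig^-1 ^+ 2.
  rewrite exprVn; apply: (@mulIf _ (sig ^+ 2)).
    by rewrite expf_neq0 ?gt_eqF.
  rewrite mulVf ?expf_neq0 ?gt_eqF//.
  have -> : 2 `^ beta = 2 / sig ^+ 3.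
    rewrite -powR_mulrn ?ltW// /sig -powRrM divfK ?gt_eqF//.
    rewrite -[X in X / _](@powRr1 R 2)// -powRB ?pnatr_eq0 ?implybT//.
    by congr (_ `^ _); ring.
  by field; rewrite gt_eqF.
have s0 : 0 < sig^-1 by rewrite invr_gt0.
have s1 : sig^-1 < 1 by rewrite invf_lt1.
have [c c0 cP] := sum_increments_ge n p1 sig1.
exists (c / (1 - sig^-1)), sig^-1; split => //.
  by rewrite divr_ge0// subr_ge0 ltW.
move=> f A eta N J cf csf A0 eta0 fA f1 NJ.
have [J' J'P] := cP f eta N (2 ^ J)%N cf csf eta0 f1.
rewrite -lee_fin; apply: (le_trans J'P).
pose geo := \sum_(j < J') c * A * eta `^ beta * sig^-1 ^+ j.
have geo_le : geo <= c / (1 - sig^-1) * A * eta `^ beta.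
  rewrite /geo -mulr_sumr.
  rewrite [leRHS](_ : _ = c * A * eta `^ beta * (1 / (1 - sig^-1))).
    2: by ring.
  apply: ler_wpM2l; first by rewrite !mulr_ge0// powR_ge0.
  have := @geometric_le_lim R J' 1 sig^-1 ler01 s0.
  rewrite ger0_norm ?(ltW s0)// => /(_ s1).
  rewrite /series /geometric/= big_mkord.
  by apply: le_trans; apply: ler_sum => i _; rewrite mul1r.
apply: (@le_trans _ _ geo%:E); last by rewrite lee_fin.
rewrite /geo -sumEFin; apply: lee_sum => j _.
set S := (\sum_(m < N) _)%E.
pose h := 2 ^+ j * eta.
have h0 : 0 < h by rewrite mulr_gt0// exprn_gt0.
pose G k := (\int[lebesgue_rV R n.+1]_(v in cell eta 0)
  (`|f (v + (k%:R * eta) *: unit_vec R ord0 + h *: unit_vec R ord0) -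
     f (v + (k%:R * eta) *: unit_vec R ord0)| `^ p)%:E)%E.
have G0 k : (0 <= G k)%E.
  by apply: integral_ge0 => v _; rewrite lee_fin powR_ge0.
have GE m : (\sum_(k < m) G k <= (A * h `^ beta)%:E)%E.
  apply: le_trans (fA h h0).
  apply: (@sum_integral_cell_le R n eta m (fun v =>
    (`|f (v + h *: unit_vec R ord0) - f v| `^ p)%:E)) => //.
  by apply/measurable_EFinP; exact: measurable_increment.
have hE : h `^ beta = (2 `^ beta) ^+ j * eta `^ beta.
  rewrite /h powRM ?exprn_ge0 ?(ltW eta0)//; congr (_ * _).
  exact: powR_expn.
have scale (g : R) : 0 <= g -> g * sig^-1 ^+ j <= 1 ->
    (S <= g%:E * (A * h `^ beta)%:E)%E ->
    ((c * (sig / 2) ^+ j)%:E * S <= (c * A * eta `^ beta * sig^-1 ^+ j)%:E)%E.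
  move=> g0 gs /(lee_wpmul2l (x := (c * (sig / 2) ^+ j)%:E)).
  rewrite lee_fin mulr_ge0 ?exprn_ge0 ?divr_ge0 ?(ltW sig0)// => /(_ isT).
  move=> /le_trans; apply; rewrite -!EFinM lee_fin hE.
  rewrite [leLHS](_ : _ =
    c * A * eta `^ beta * (sig / 2 * 2 `^ beta) ^+ j * g); last first.
    by rewrite (exprMn j (sig / 2) (2 `^ beta)); ring.
  rewrite sigE -exprM mulnC exprM expr2.
  rewrite [leLHS](_ : _ =
    c * A * eta `^ beta * sig^-1 ^+ j * (g * sig^-1 ^+ j)).
    by rewrite ler_piMr// !mulr_ge0 ?powR_ge0 ?exprn_ge0 ?(ltW s0).
  by ring.
have [jJ|Jj] := leqP j J.
  apply: (scale 1) => //; first by rewrite mul1r exprn_ile1 ?ltW.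
  rewrite mul1e; apply: (sum_windows_disjoint G0 GE).
  by rewrite leq_exp2l.
apply: (scale N%:R) => //; last exact: (sum_windows_le G0 GE).
apply: le_trans NJ; rewrite ler_wpM2l//.
by apply: ler_wiXn2l; rewrite ?(ltW s0) ?(ltW s1)// ltnW.
Qed.

(** * Open sets of small measure and large capacity *)

Section large_capacity.
Variables (R : realType) (n : nat).

Lemma open_prism (A B : set R) : open A -> open B -> open (@prism R n A B).
Proof.
move=> oA oB; rewrite prismE openE => v vAB.
have := @filter_forall _ _ (fun i (w : 'rV[R]_n.+1) =>
  (if i == ord0 then A else B) (w 0 i)) _ (nbhs_filter v).
apply => i.
have oi : open (if i == ord0 then A else B) by case: ifP.
exact: (@coord_continuous R 1 n.+1 0 i v _ (open_nbhs_nbhs (conj oi (vAB i)))).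
Qed.

Lemma compact_prism (A B : set R) :
  compact A -> compact B -> compact (@prism R n A B).
Proof.
move=> cA cB; rewrite prismE.
apply: (@rV_compact R n.+1 (fun i => if i == ord0 then A else B)) => i.
by case: ifP.
Qed.

Lemma cap_open_ge (p q alpha : R) (K G : set 'rV[R]_n) (x : \bar R) :
  compact K -> K `<=` G ->
  (forall f, admissible K f -> (x <= besov_seminorm p q alpha f `^ p)%E) ->
  (x <= cap_open p q alpha G)%E.
Proof.
move=> cK KG xf; apply: (@le_trans _ _ (cap_compact p q alpha K)).
  by apply: le_ereal_inf_tmp => _ [f Kf <-]; exact: xf.
by apply: ereal_sup_ubound; exists K.
Qed.

Lemma cap_open_le (p q alpha : R) (G H : set 'rV[R]_n) :
  G `<=` H -> (cap_open p q alpha G <= cap_open p q alpha H)%E.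
Proof.
move=> GH; apply: ereal_sup_le => _ [K [cK KG] <-].
by exists K => //; split => //; exact: subset_trans GH.
Qed.

End large_capacity.

(** A large number of thin cells of fixed total width, at a mutual distance
    that is large with respect to this number, has as large a capacity as
    desired. The open set G is a neighbourhood of these cells, three times
    as wide along every axis. *)
Lemma large_capacity_small_measure (R : realType) (n : nat)
    (p alpha M eps : R) :
  1 < p -> 0 < alpha -> alpha * p < 1 -> 0 <= M -> 0 < eps ->
  exists G : set 'rV[R]_n.+1, [/\ open G,
    (lebesgue_rV R n.+1 G <= eps%:E)%E & (M%:E <= cap_open p p alpha G)%E].
Proof.
move=> p1 a0 b1 M0 eps0; set beta := alpha * p in b1.
have b0 : 0 < beta by rewrite mulr_gt0// (lt_trans _ p1).
have [C [s [C0 s0 s1 CP]]] := spaced_cells_energy n p1 b0 b1.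
pose eps' := eps / 3 ^+ n.+1.
have eps'0 : 0 < eps' by rewrite divr_gt0// exprn_gt0.
pose A := 2 * 2 `^ beta * M.
have A0 : 0 <= A by rewrite !mulr_ge0// powR_ge0.
pose w := eps' / (C * A + 1).
have q0 : 0 < C * A + 1 by rewrite ltr_wpDl// mulr_ge0.
have w0 : 0 < w by rewrite divr_gt0.
(* the width eta = eps' / N is so small that C * A * eta^beta < eps' *)
pose N := (Num.truncn (eps' / w `^ beta^-1)).+1.
have N0 : (0 : R) < N%:R by rewrite ltr0n.
pose eta := eps' / N%:R.
have eta0 : 0 < eta by rewrite divr_gt0.
have etaw : eta `^ beta < w.
  have -> : w = (w `^ beta^-1) `^ beta.
    by rewrite -powRrM mulVf ?gt_eqF// powRr1// ltW.
  apply: gt0_ltr_powR; rewrite ?nnegrE ?powR_ge0 ?(ltW eta0)//.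
  rewrite /eta ltr_pdivrMr// mulrC -ltr_pdivrMr ?powR_gt0//.
  exact: truncnS_gt.
have [J NJ] : exists J, N%:R * s ^+ J <= 1.
  have s_lt1 : `|s| < 1 by rewrite ger0_norm// ltW.
  have /cvgrPdist_lt/(_ 1 ltr01)[J _ /(_ J (leqnn J))] :=
    cvg_geometric N%:R s_lt1.
  rewrite /= sub0r normrN => h; exists J.
  exact: le_trans (ler_norm _) (ltW h).
pose k m := (m * 2 ^ J)%N.
pose I m : set R := `[(k m)%:R * eta, (k m).+1%:R * eta]%classic.
pose I' m : set R := `](k m)%:R * eta - eta, (k m)%:R * eta + 2 * eta[%classic.
have II' m : I m `<=` I' m.
  move=> x; rewrite /I /I' /= !in_itv/= -natr1 mulrDl mul1r => /andP[]; lra.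
pose K : set 'rV[R]_n.+1 := prism (\big[setU/set0]_(m < N) I m) `[0, 1]%classic.
pose G : set 'rV[R]_n.+1 :=
  prism (\big[setU/set0]_(m < N) I' m) `](-1), 2[%classic.
have mI' : measurable (\big[setU/set0]_(m < N) I' m).
  by apply: bigsetU_measurable => m _; exact: measurable_itv.
exists G; split.
- apply: open_prism; last exact: interval_open.
  rewrite -bigcup_mkord; apply: bigcup_open => m _; exact: interval_open.
- rewrite lebesgue_rV_prism//.
  have -> : (\prod_(i < n) @lebesgue_measure R `](-1)%R, 2%R[%classic =
      (3 ^+ n)%:E)%E.
    under eq_bigr => i _.
      rewrite lebesgue_measure_itv/= lte_fin (_ : -1 < 2); last by lra.
      rewrite -EFinB (_ : 2 - -1 = 3); last by ring.
      over.
    by rewrite prodEFin prodr_const card_ord.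
  have I'le : (@lebesgue_measure R (\big[setU/set0]_(m < N) I' m) <=
      (3 * eps')%:E)%E.
    have sub : (@lebesgue_measure R (\big[setU/set0]_(m < N) I' m) <=
        \sum_(m < N) @lebesgue_measure R (I' m))%E.
      apply: (@content_subadditive _ _ _ (@lebesgue_measure R)) => //.
      by move=> m _; exact: measurable_itv.
    apply: (le_trans sub).
    have II m : @lebesgue_measure R (I' m) = (3 * eta)%:E.
      rewrite lebesgue_measure_itv/= lte_fin ifT; last by lra.
      by rewrite -EFinB; congr (_%:E); ring.
    under eq_bigr do rewrite II.
    rewrite sumEFin sumr_const card_ord lee_fin -[leLHS]mulr_natl.
    by rewrite mulrCA /eta (mulrC N%:R) divfK// gt_eqF.
  apply: (le_trans (lee_wpmul2r _ I'le)); first by rewrite lee_fin exprn_ge0.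
  rewrite -EFinM lee_fin /eps' exprS.
  by rewrite [leLHS](_ : _ = eps)//; field; rewrite expf_neq0.
- apply: (@cap_open_ge _ _ _ _ _ K).
  + apply: compact_prism; last exact: segment_compact.
    by apply: bigsetU_compact => m _; exact: segment_compact.
  + move=> v [v0 vB]; split.
      move: v0; rewrite -!bigcup_mkord => -[m mN vm].
      by exists m => //; exact: II'.
    by move=> i; move: (vB i); rewrite /= !in_itv/=; lra.
  move=> f [fs fc f1]; rewrite leNgt; apply/negP => XM.
  have cf : continuous f := (fs [::]).1.
  have : N%:R * eta <= C * A * eta `^ beta.
    apply: (CP f A eta N J) => //.
      move=> h h0; apply: (le_trans (integral_increment_le p1 a0 f h0)).
      apply: (le_trans (lee_wpmul2l _ (ltW XM))).
        by rewrite lee_fin mulr_ge0// powR_ge0.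
      rewrite -EFinM lee_fin /A -/beta powRM// ?(ltW h0)//.
      by rewrite [leLHS](_ : _ = 2 * 2 `^ beta * M * h `^ beta)//; ring.
    move=> m v mN [v0 vB]; apply: f1; split => //.
    rewrite -bigcup_mkord; exists m => //.
    by move: v0; rewrite /I /= !in_itv/= => /andP[-> /ltW ->].
  apply/negP; rewrite -ltNge [ltRHS](_ : _ = eps'); last first.
    by rewrite mulrC divfK// gt_eqF.
  apply: (@le_lt_trans _ _ (C * A * w)).
    by rewrite ler_wpM2l ?mulr_ge0// ltW.
  by rewrite /w mulrA ltr_pdivrMr// mulrDr mulr1 mulrC ltrDl.
Qed.

(** The values of the smoothness parameter at which the capacity is forced to be
    large: they tend to 0 and satisfy alpha p < 1. *)
Definition small_smoothness (R : realType) (p : R) (j : nat) : R :=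
  (p * j.+2%:R)^-1.

Lemma small_smoothness_gt0 (R : realType) (p : R) j : 0 < p ->
  0 < small_smoothness p j.
Proof. by move=> p0; rewrite invr_gt0 mulr_gt0. Qed.

Lemma small_smoothness_near (R : realType) (p : R) (V : set R) : 0 < p ->
  (0^'+)%R V -> exists j, V (small_smoothness p j).
Proof.
move=> p0 [e /= e0 eV].
pose j := Num.truncn (e^-1 / p).
exists j; apply: eV; last exact: small_smoothness_gt0.
rewrite /= sub0r normrN ger0_norm ?(ltW (small_smoothness_gt0 _ p0))//.
rewrite /small_smoothness invf_plt ?posrE ?mulr_gt0// mulrC -ltr_pdivrMr//.
by apply: (lt_trans (truncnS_gt _)); rewrite ltr_nat.
Qed.

(** A union of open sets of summable measures, the j-th one having capacity at
    least 1 / alpha for the j-th value alpha of the smoothness. *)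
Lemma small_open_large_capacity (R : realType) (n : nat) (p eps : R) :
  1 < p -> 0 < eps ->
  exists G : set 'rV[R]_n.+1, [/\ open G, (lebesgue_rV R n.+1 G < eps%:E)%E &
    forall j, (1 <= (small_smoothness p j)%:E *
                    cap_open p p (small_smoothness p j) G)%E].
Proof.
move=> p1 eps0; have p0 : 0 < p by rewrite (lt_trans _ p1).
pose a := small_smoothness p.
have a0 j : 0 < a j by exact: small_smoothness_gt0.
have /choice[G GP] : forall j, exists G : set 'rV[R]_n.+1, [/\ open G,
    (lebesgue_rV R n.+1 G <= (eps / 2 / (2 ^ j.+1)%:R)%:E)%E &
    ((a j)^-1%:E <= cap_open p p (a j) G)%E].
  move=> j; apply: large_capacity_small_measure => //.
  - rewrite /a /small_smoothness invfM mulrAC mulVf ?gt_eqF// mul1r.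
    by rewrite invf_lt1 ?ltr0n// ltr1n.
  - by rewrite invr_ge0 ltW.
  - by rewrite !divr_gt0// ltr0n expn_gt0.
have oG j : open (G j) by have [] := GP j.
exists (\bigcup_j G j); split.
- by apply: bigcup_open => j _.
- have mG j : measurable (G j) := measurable_open_rV (oG j).
  have sub : (lebesgue_rV R n.+1 (\bigcup_j G j) <=
      \sum_(0 <= j <oo) lebesgue_rV R n.+1 (G j))%E.
    apply: measure_sigma_subadditive => //.
    exact: bigcup_measurable.
  apply: (le_lt_trans sub); apply: (@le_lt_trans _ _ (eps / 2)%:E); last first.
    by rewrite lte_fin; lra.
  apply: le_trans (@epsilon_trick0 R (eps / 2) xpredT _).
    by apply: lee_nneseries => // j _; have [] := GP j.
  by rewrite divr_ge0// ltW.
- move=> j; have [_ _ capj] := GP j.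
  rewrite -lee_pdivrMl// mule1; apply: (le_trans capj).
  by apply: cap_open_le; exact: bigcup_sup.
Qed.

Theorem mainTheorem4 (R : realType) (n : nat) (p : R) :
  (0 < n)%N -> 1 < p ->
  (forall eps : R, 0 < eps -> eps < 1 ->
    exists G : set 'rV[R]_n,
      [/\ open G,
          (lebesgue_rV R n G < eps%:E)%E &
          (1%:E <= limf_esup
             (fun alpha : R => (alpha%:E * cap_open p p alpha G)%E) 0^'+)%E])
  /\
  (exists G : set 'rV[R]_n, open G /\ ~ cap_limit_formula p p G).
Proof.
case: n => // n _ p1; have p0 : 0 < p by rewrite (lt_trans _ p1).
split=> [eps eps0 _|].
  have [G [oG Geps G1]] := small_open_large_capacity n p1 eps0.
  exists G; split => //; apply: le_ereal_inf_tmp => _ [V V0 <-].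
  have [j Vj] := small_smoothness_near p0 V0.
  apply: (le_trans (G1 j)); apply: ereal_sup_ubound.
  by exists (small_smoothness p j).
pose c : R := 2 * n.+1%:R `^ p * p^-1 `^ (p / p).
have c0 : 0 < c by rewrite !mulr_gt0// powR_gt0// invr_gt0.
(* the measure is taken so small that the limit in the formula is below 1 *)
have [|G [oG Geps G1]] := @small_open_large_capacity R n p c^-1 p1.
  by rewrite invr_gt0.
exists G; split => // lim_formula.
have lim_lt1 : (c%:E * lebesgue_rV R n.+1 G < 1)%E.
  by rewrite -lte_pdivlMl// mule1.
have := lim_formula _
  (open_nbhs_nbhs (conj (@open_ereal_lt_ereal R 1%E) lim_lt1)).
move=> /(small_smoothness_near p0)[j]; rewrite /= divff ?gt_eqF//.
rewrite powRr1 ?(ltW (small_smoothness_gt0 _ p0))//.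
by rewrite ltNge G1.
Qed.
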